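(* Let $\mathbb{F}$ be a field endowed with an archimedean absolute value $|\cdot|$, and let $\sigma:\mathbb{F}\to\mathbb{C}$ be a field embedding and $c>0$ a real number such that $|x|=|\sigma(x)|_\infty^{c}$ for all $x\in\mathbb{F}$ (such $\sigma$ and $c$ exist by Ostrowski's theorem), where $|\cdot|_\infty$ is the usual absolute value on $\mathbb{C}$. Equip $\mathbb{F}$ with the metric $d(x,y)=|x-y|$. Then: (1) If $\sigma(\mathbb{F})\subseteq\mathbb{R}$, then $\mathrm{md}(\mathbb{F})=2$. (2) If $\sigma(\mathbb{F})\nsubseteq\mathbb{R}$, then $2\le\mathrm{md}(\mathbb{F})\le 3$. Furthermore, in this case, $\mathrm{md}(\mathbb{F})=3$ if and only if there exists $z\in\sigma(\mathbb{F})\setminus\mathbb{R}$ such that $\overline{z}\in\sigma(\mathbb{F})$.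
   Context: An absolute value on a field $\mathbb{F}$ is a function $|\cdot|:\mathbb{F}\to[0,\infty)$ with (i) $|x|=0$ if and only if $x=0$; (ii) $|xy|=|x||y|$ for all $x,y$; (iii) $|x+y|\le|x|+|y|$ for all $x,y$. It is non-archimedean if $|x+y|\le\max(|x|,|y|)$ for all $x,y$, and archimedean otherwise. For a metric space $(X,d)$, a subset $A\subseteq X$ is resolving if the map $x\mapsto(d(x,a))_{a\in A}$ from $X$ to $\mathbb{R}^A$ is injective, i.e. if $d(x,a)=d(y,a)$ for all $a\in A$ implies $x=y$. The metric dimension $\mathrm{md}(X)$ is the smallest cardinality of a resolving set for $X$. $\overline{z}$ denotes the complex conjugate of $z$. *)

(* Defs.v *)
From HB Require Import structures.
From mathcomp Require Import all_boot all_order all_algebra.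
From mathcomp Require Import all_classical all_reals.
From mathcomp Require Import exp.
From mathcomp Require Export complex.

Set Implicit Arguments.
Unset Strict Implicit.
Unset Printing Implicit Defensive.
Import Order.TTheory GRing.Theory Num.Theory.
Local Open Scope ring_scope.
Local Open Scope classical_set_scope.
Local Open Scope card_scope.

Record absolute_value (R : realType) (F : fieldType) (v : F -> R) : Prop :=
  AbsoluteValue {
    absval_ge0 : forall x, 0 <= v x;
    absval_eq0 : forall x, v x = 0 <-> x = 0;
    absvalM : forall x y, v (x * y) = v x * v y;
    absvalD : forall x y, v (x + y) <= v x + v y }.

Definition nonarchimedean (R : realType) (F : fieldType) (v : F -> R) : Prop :=
  forall x y, v (x + y) <= Num.max (v x) (v y).

Definition archimedean_absolute_value (R : realType) (F : fieldType)
    (v : F -> R) : Prop :=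
  absolute_value v /\ ~ nonarchimedean v.

Definition absval_dist (R : realType) (F : fieldType) (v : F -> R) (x y : F) : R :=
  v (x - y).

(* The norm of mathcomp's numDomainType structure on R[i] takes its values in
   R[i]; this is the usual absolute value with values in R. *)
Definition cabs (R : realType) (z : R[i]) : R := ComplexField.Normc.normc z.

Definition resolving (R : realType) (X : Type) (d : X -> X -> R) (A : set X) : Prop :=
  forall x y, (forall a, A a -> d x a = d y a) -> x = y.

(* [is_metric_dim d n] reads md(X, d) = n.  It is a relation because md is a
   cardinal and may be infinite; the second conjunct also ranges over infinite
   resolving sets. *)
Definition is_metric_dim (R : realType) (X : Type) (d : X -> X -> R) (n : nat) : Prop :=
  (exists2 A : set X, resolving d A & A #= `I_n) /\
  (forall A : set X, resolving d A -> `I_n #<= A).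

Lemma is_metric_dim_unique (R : realType) (X : Type) (d : X -> X -> R) (m n : nat) :
  is_metric_dim d m -> is_metric_dim d n -> m = n.
Proof.
have le p q : is_metric_dim d p -> is_metric_dim d q -> (p <= q)%N.
  move=> [_ lep] [[A rA Aq] _].
  by rewrite -card_le_II -(card_le_eqr Aq); exact: lep.
by move=> dm dn; apply/eqP; rewrite eqn_leq !le.
Qed.

(* Main.v *)
Require Import Defs.
From mathcomp Require Import all_boot all_order all_algebra.
From mathcomp Require Import all_classical all_reals.
From mathcomp Require Import exp.
From mathcomp Require Import complex.
From mathcomp Require Import finmap ring lra.
Set Implicit Arguments.
Unset Strict Implicit.
Unset Printing Implicit Defensive.
Import Order.TTheory GRing.Theory Num.Theory.

Local Open Scope ring_scope.
Local Open Scope classical_set_scope.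

(** Two points of the plane with the same distances to 0 and to 1 are equal or
    conjugate.  Hence [{0, 1}] resolves F unless sigma(F) contains a conjugate
    pair of non-real numbers, while adding a third point off the real axis
    always separates conjugates.  Conversely a non-real conjugate pair z, z' in
    sigma(F) can be transported by the similarity [t |-> a + (b - a) t], which
    exhibits two points of F that [{a, b}] does not separate. *)

Lemma card_set_seq (T : choiceType) (s : seq T) :
  uniq s -> ([set` s] #= `I_(size s))%card.
Proof.
move=> us; have -> : [set` s] = [set` [fset x in s]%fset].
  by apply/seteqP; split=> x /=; rewrite inE.
by apply/card_eq_fsetP; rewrite card_fseq undup_id.
Qed.

(** A finite [A] is enumerated by a duplicate-free list, which by hypothesis must be longer than
    [n]; an infinite [A] contains a copy of the naturals. *)
Lemma card_ge_not_sub_seq (T : choiceType) (A : set T) (n : nat) :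
  (forall s : seq T, uniq s -> (size s <= n)%N -> ~ (A `<=` [set` s])) ->
  (`I_n.+1 #<= A)%card.
Proof.
move=> hA; have [/finite_seqP[s As]|/infiniteP iA] := pselect (finite_set A).
- have As' : A = [set` undup s].
    by rewrite As; apply/seteqP; split=> x /=; rewrite mem_undup.
  have us := undup_uniq s.
  rewrite As' (card_le_eqr (card_set_seq us)) card_le_II ltnNge; apply/negP => ns.
  by apply: (hA _ us ns); rewrite As'.
- by apply: card_le_trans iA; apply: subset_card_le.
Qed.

Lemma resolvingS (R : realType) (X : Type) (d : X -> X -> R) (A B : set X) :
  A `<=` B -> resolving d A -> resolving d B.
Proof. by move=> AB rA x y h; apply: rA => a /AB; exact: h. Qed.

(** Supersets of resolving sets resolve, so refuting the short lists rules out every smaller set,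
    and a bound over all sets becomes one over lists. *)
Lemma is_metric_dim_seq (R : realType) (X : choiceType) (d : X -> X -> R)
    (s : seq X) (n : nat) :
  uniq s -> size s = n.+1 -> resolving d [set` s] ->
  (forall t : seq X, uniq t -> (size t <= n)%N -> ~ resolving d [set` t]) ->
  is_metric_dim d n.+1.
Proof.
move=> us sn rs nr; split; first by exists [set` s] => //; rewrite -sn; exact: card_set_seq.
move=> A rA; apply: card_ge_not_sub_seq => t ut tn At.
by apply: (nr t ut tn); exact: resolvingS rA.
Qed.

Lemma eq_cabs (R : realType) (x y : R[i]) :
  cabs x = cabs y <->
  complex.Re x ^+ 2 + complex.Im x ^+ 2 = complex.Re y ^+ 2 + complex.Im y ^+ 2.
Proof.
case: x y => [a b] [c d]; rewrite /cabs /=; split=> [/eqP|->//].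
by rewrite eqr_sqrt ?addr_ge0 ?sqr_ge0// => /eqP.
Qed.

Lemma cabs_conj (R : realType) (x : R[i]) : cabs (conjc x) = cabs x.
Proof. by case: x => a b; apply/eq_cabs; rewrite /= sqrrN. Qed.

(* [- 0] is what the imaginary part of [x - 1] computes to. *)
Lemma eq_sqr_norm01 (R : realFieldType) (a b c d : R) :
  a ^+ 2 + b ^+ 2 = c ^+ 2 + d ^+ 2 ->
  (a - 1) ^+ 2 + (b - 0) ^+ 2 = (c - 1) ^+ 2 + (d - 0) ^+ 2 ->
  c = a /\ d ^+ 2 = b ^+ 2.
Proof.
(* Subtracting the hypotheses cancels all squares and leaves [1 - 2 * a = 1 - 2 * c]. *)
move=> e0 e1; have ac : c = a by lra.
by split=> //; move: e0; rewrite ac; lra.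
Qed.

Lemma eq_cabs01 (R : realType) (x y : R[i]) :
  cabs x = cabs y -> cabs (x - 1) = cabs (y - 1) -> y = x \/ y = conjc x.
Proof.
case: x y => [a b] [c d] /eq_cabs e0 /eq_cabs e1.
have [/= -> /eqP] := eq_sqr_norm01 e0 e1.
by rewrite eqf_sqr => /orP[]/eqP ->; [left|right].
Qed.

Lemma eq_sqr_norm_conj (R : realFieldType) (a b c d : R) :
  (a - c) ^+ 2 + (b - d) ^+ 2 = (a - c) ^+ 2 + (- b - d) ^+ 2 -> b * d = 0.
Proof. by move=> e; lra. Qed.

(** For non-real [x], the perpendicular bisector of [x] and [conjc x] is the real axis, which misses
    [w]. *)
Lemma eq_cabs_conj (R : realType) (x w : R[i]) : w \isn't Num.real ->
  cabs (x - w) = cabs (conjc x - w) -> conjc x = x.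
Proof.
case: x w => [a b] [c d]; rewrite complex_real => d0 /eq_cabs e.
by have /eqP := eq_sqr_norm_conj e; rewrite mulf_eq0 (negbTE d0) orbF => /eqP /= ->; rewrite oppr0.
Qed.

Lemma conjc_id_real (R : realType) (x : R[i]) :
  (conjc x == x) = (x \is Num.real).
Proof.
by case: x => a b; rewrite complex_real eq_complex /= eqxx eqNr.
Qed.

Section ArchimedeanField.
Variables (R : realType) (F : fieldType) (v : F -> R).
Variables (sigma : {rmorphism F -> R[i]}) (c : R).
Hypotheses (hc : 0 < c) (hsigma : forall x : F, v x = cabs (sigma x) `^ c).

(** Since [c] is positive, the power map is injective on nonnegative reals; all comparisons of
    distances thus move to the complex plane. *)
Let eq_absval (x y : F) : v x = v y <-> cabs (sigma x) = cabs (sigma y).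
Proof.
have cabs_nneg (z : R[i]) : cabs z \in Num.nneg.
  by case: z => a b; rewrite nnegrE /cabs /= sqrtr_ge0.
by rewrite !hsigma; split=> [|-> //]; apply: powR_injective.
Qed.

Lemma absval_dist01 (x y : F) :
  absval_dist v x 0 = absval_dist v y 0 ->
  absval_dist v x 1 = absval_dist v y 1 ->
  y = x \/ sigma y = conjc (sigma x).
Proof.
rewrite /absval_dist !subr0 => /eq_absval e0 /eq_absval.
rewrite !rmorphB rmorph1 => e1.
by have [/fmorph_inj|] := eq_cabs01 e0 e1; [left|right].
Qed.

Lemma resolving01 :
  (forall z, range sigma z -> range sigma (conjc z) -> z \is Num.real) ->
  resolving (absval_dist v) [set` [:: 0; 1 : F]].
Proof.
move=> hreal x y h.
have [//|e] : y = x \/ sigma y = conjc (sigma x).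
  by apply: absval_dist01; apply: h; rewrite /= !inE eqxx ?orbT.
have : sigma x \is Num.real by apply: hreal; [exists x|rewrite -e; exists y].
by rewrite -conjc_id_real -e => /eqP/fmorph_inj.
Qed.

Lemma resolving01w (w : F) : sigma w \isn't Num.real ->
  resolving (absval_dist v) [set` [:: 0; 1; w]].
Proof.
move=> hw x y h.
have [//|e] : y = x \/ sigma y = conjc (sigma x).
  by apply: absval_dist01; apply: h; rewrite /= !inE eqxx ?orbT.
have /eq_absval : absval_dist v x w = absval_dist v y w.
  by apply: h; rewrite /= !inE eqxx ?orbT.
by rewrite !rmorphB e => /(eq_cabs_conj hw); rewrite -e => /fmorph_inj.
Qed.

Lemma not_resolving_size1 (s : seq F) :
  (size s <= 1)%N -> ~ resolving (absval_dist v) [set` s].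
Proof.
case: s => [|a [|//]] _ rs.
  (* The empty set separates nothing, not even 0 and 1. *)
  have /eqP : (1 : F) = 0 by apply: rs.
  by rewrite oner_eq0.
(* The reflection in [a] preserves distances to [a], so [a] alone cannot separate [a + 1] from
   [a - 1]. *)
have e : a + 1 = a - 1.
  apply: rs => _ /= /[!inE] /eqP ->; rewrite /absval_dist.
  have -> : a + 1 - a = 1 by ring.
  have -> : a - 1 - a = -1 by ring.
  apply/eq_absval; rewrite rmorphN rmorph1.
  by apply/eq_cabs; rewrite /= !sqrrN.
(* What remains is [1 = - 1], refuted in the complex numbers, where the characteristic is 0. *)
move/addrI/(congr1 sigma)/eqP: e.
by rewrite rmorphN rmorph1 eq_sym eqNr oner_eq0.
Qed.

Hypothesis hv : absolute_value v.

Lemma not_resolving_size2 (z : R[i]) (s : seq F) :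
  range sigma z -> z \isn't Num.real -> range sigma (conjc z) ->
  uniq s -> (size s <= 2)%N -> ~ resolving (absval_dist v) [set` s].
Proof.
move=> [x _ xz] nz [y _ yz] us s2.
have [|s1] := leqP (size s) 1; first exact: not_resolving_size1.
case: s us s2 s1 => [|a [|b [|//]]] //= /[!inE] /andP[nab _] _ _ rs.
(* The similarity sends 0 to [a] and 1 to [b], and scales distances by [v (b - a)]. It remains to
   see that [x] and [y] are equidistant from 0 and from 1. *)
have e : a + (b - a) * x = a + (b - a) * y.
  apply: rs => t /= /[!inE] /orP[]/eqP ->; rewrite /absval_dist.
    rewrite ![a + _]addrC !addrK !(absvalM hv); congr (_ * _).
    by apply/eq_absval; rewrite xz yz cabs_conj.
  have h u : a + (b - a) * u - b = (b - a) * (u - 1) by ring.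
  rewrite !h !(absvalM hv); congr (_ * _).
  apply/eq_absval; rewrite !rmorphB rmorph1 xz yz.
  (* Reading 1 as its own conjugate turns [conjc z - 1] into [conjc (z - 1)]. *)
  by rewrite -[in RHS](rmorph1 (@conjc R)) -rmorphB cabs_conj.
have ba : b - a != 0 by rewrite subr_eq0 eq_sym.
move/addrI/(mulfI ba)/(congr1 sigma): e; rewrite xz yz => e.
by move: nz; rewrite -conjc_id_real -e eqxx.
Qed.

Lemma metric_dim2 :
  (forall z, range sigma z -> range sigma (conjc z) -> z \is Num.real) ->
  is_metric_dim (absval_dist v) 2.
Proof.
move=> h; apply: (@is_metric_dim_seq _ _ _ [:: 0; 1]) => //.
- by rewrite /= inE eq_sym oner_eq0.
- exact: resolving01.
- by move=> t _; exact: not_resolving_size1.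
Qed.

Lemma metric_dim3 (z : R[i]) :
  range sigma z -> z \isn't Num.real -> range sigma (conjc z) ->
  is_metric_dim (absval_dist v) 3.
Proof.
move=> rz nz rz'; have [w _ wz] := rz.
have nw : sigma w \isn't Num.real by rewrite wz.
apply: (@is_metric_dim_seq _ _ _ [:: 0; 1; w]) => //.
(* [w] differs from 0 and 1 because their images under [sigma] are real. *)
- rewrite /= !inE eq_sym oner_eq0 /= andbT; apply/andP; split.
    by apply: contraNneq nw => <-; rewrite rmorph0 real0.
  by apply: contraNneq nw => <-; rewrite rmorph1 real1.
- exact: resolving01w.
- by move=> t; exact: not_resolving_size2 rz nz rz'.
Qed.

End ArchimedeanField.

Theorem proposition2p1 (R : realType) (F : fieldType) (v : F -> R)
    (hv : archimedean_absolute_value v)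
    (sigma : {rmorphism F -> R[i]}) (c : R) (hc : 0 < c)
    (hsigma : forall x : F, v x = cabs (sigma x) `^ c) :
  (range sigma `<=` [set z : R[i] | z \is Num.real] ->
     is_metric_dim (absval_dist v) 2)
  /\
  (~ (range sigma `<=` [set z : R[i] | z \is Num.real]) ->
     (exists n : nat, is_metric_dim (absval_dist v) n /\ (2 <= n <= 3)%N)
     /\
     (is_metric_dim (absval_dist v) 3 <->
        exists z : R[i],
          [/\ range sigma z, z \isn't Num.real & range sigma (conjc z)])).
Proof.
have [av _] := hv.
split=> [rreal|_]; first by apply: (metric_dim2 hc hsigma) => z /rreal.
pose P := exists z : R[i],
  [/\ range sigma z, z \isn't Num.real & range sigma (conjc z)].
have dim3 : P -> is_metric_dim (absval_dist v) 3.
  by move=> [z [rz nz rz']]; exact: metric_dim3 hc hsigma av _ rz nz rz'.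
have dim2 : ~ P -> is_metric_dim (absval_dist v) 2.
  move=> nP; apply: (metric_dim2 hc hsigma) => z rz rz'.
  by apply: contrapT => /negP nz; apply: nP; exists z.
split; last first.
  split=> [d3|]; last exact: dim3.
  (* Without a conjugate pair the dimension would be both 2 and 3. *)
  by apply: contrapT => /dim2 d2; have := is_metric_dim_unique d2 d3.
have [/dim3 d3|/dim2 d2] := pselect P; first by exists 3%N.
by exists 2%N.
Qed.
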